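(* Let $\mathbf{X}$ be any one of the logics $\mathbf{E}$, $\mathbf{E}\oplus N$, $\mathbf{E}\oplus M$, $\mathbf{E}\oplus M\oplus N$, $\mathbf{E}\oplus M\oplus C$, $\mathbf{E}\oplus M\oplus C\oplus N$, $\mathbf{E}\oplus D^\bot$, $\mathbf{E}\oplus N\oplus D^\bot$, $\mathbf{E}\oplus D^\Diamond$, $\mathbf{E}\oplus D^\bot\oplus D^\Diamond$, $\mathbf{E}\oplus N\oplus D^\bot\oplus D^\Diamond$, $\mathbf{E}\oplus M\oplus D^\bot$, $\mathbf{E}\oplus M\oplus N\oplus D^\bot$, $\mathbf{E}\oplus M\oplus D^\bot\oplus D^\Diamond$, $\mathbf{E}\oplus M\oplus N\oplus D^\bot\oplus D^\Diamond$, $\mathbf{E}\oplus M\oplus C\oplus D^\bot\oplus D^\Diamond$, $\mathbf{E}\oplus M\oplus C\oplus N\oplus D^\bot\oplus D^\Diamond$ (i.e. any logic in this family other than $\mathbf{E}\oplus C$, $\mathbf{E}\oplus C\oplus N$ and their deontic extensions). If $A\supset B$ is a theorem of $\mathbf{X}$, then there is a formula $I$ all of whose propositional variables occur in both $A$ and $B$ such that both $A\supset I$ and $I\supset B$ are theorems of $\mathbf{X}$.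
   Context: Formulas are generated from countably many propositional variables $p_0,p_1,\dots$ and the $0$-ary constant $\bot$ by the binary connectives $\wedge,\vee,\supset$ and the unary operator $\Box$ (so a formula may contain no propositional variable at all, e.g. $\bot$); $\neg A:=A\supset\bot$, $\top:=\bot\supset\bot$, $A\leftrightarrow B:=(A\supset B)\wedge(B\supset A)$, $\Diamond A:=\neg\Box\neg A$. Axiomatic systems: $\mathbf{L}$ has as axioms all instances (in this language) of propositional tautologies and modus ponens as its rule; $\mathbf{E}$ is $\mathbf{L}$ plus the rule $RE$: from $A\leftrightarrow B$ infer $\Box A\leftrightarrow\Box B$. Axiom schemes: $M$: $\Box(A\wedge B)\supset(\Box A\wedge\Box B)$; $C$: $(\Box A\wedge\Box B)\supset\Box(A\wedge B)$; $N$: $\Box\top$; $D^\bot$: $\neg\Box\bot$; $D^\Diamond$: $\Box A\supset\Diamond A$. $\mathbf{E}\oplus S_1\oplus\dots\oplus S_k$ denotes the extension of $\mathbf{E}$ by all instances of the schemes $S_1,\dots,S_k$ as axioms (closed under modus ponens and $RE$). *)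

(* Defs.v *)
From Stdlib Require Import List.
Import ListNotations.

Inductive form : Type :=
| Var (p : nat)
| Bot
| And (A B : form)
| Or (A B : form)
| Imp (A B : form)
| Box (A : form).

Definition Neg (A : form) : form := Imp A Bot.
Definition Top : form := Imp Bot Bot.
Definition Iff (A B : form) : form := And (Imp A B) (Imp B A).
Definition Dia (A : form) : form := Neg (Box (Neg A)).

Fixpoint occurs (p : nat) (A : form) : Prop :=
  match A with
  | Var q => p = q
  | Bot => False
  | And B C | Or B C | Imp B C => occurs p B \/ occurs p C
  | Box B => occurs p B
  end.

(* Classical propositional (Box-free) formulas: the templates of which the
   axioms of the base system are substitution instances. *)
Inductive pform : Type :=
| PVar (n : nat)
| PBot
| PAnd (P Q : pform)
| POr (P Q : pform)
| PImp (P Q : pform).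

Fixpoint peval (v : nat -> bool) (P : pform) : bool :=
  match P with
  | PVar n => v n
  | PBot => false
  | PAnd Q R => andb (peval v Q) (peval v R)
  | POr Q R => orb (peval v Q) (peval v R)
  | PImp Q R => implb (peval v Q) (peval v R)
  end.

Definition tautology (P : pform) : Prop := forall v, peval v P = true.

Fixpoint psubst (s : nat -> form) (P : pform) : form :=
  match P with
  | PVar n => s n
  | PBot => Bot
  | PAnd Q R => And (psubst s Q) (psubst s R)
  | POr Q R => Or (psubst s Q) (psubst s R)
  | PImp Q R => Imp (psubst s Q) (psubst s R)
  end.

Inductive scheme : Type := SM | SC | SN | SDbot | SDdia.

Inductive instance : scheme -> form -> Prop :=
| inst_M A B : instance SM (Imp (Box (And A B)) (And (Box A) (Box B)))
| inst_C A B : instance SC (Imp (And (Box A) (Box B)) (Box (And A B)))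
| inst_N : instance SN (Box Top)
| inst_Dbot : instance SDbot (Neg (Box Bot))
| inst_Ddia A : instance SDdia (Imp (Box A) (Dia A)).

(* [thm X A]: A is a theorem of the extension of E by the schemes in X. *)
Inductive thm (X : list scheme) : form -> Prop :=
| thm_taut P s : tautology P -> thm X (psubst s P)
| thm_ax S A : In S X -> instance S A -> thm X A
| thm_mp A B : thm X (Imp A B) -> thm X A -> thm X B
| thm_re A B : thm X (Iff A B) -> thm X (Iff (Box A) (Box B)).

Definition logics : list (list scheme) :=
  [ [];
    [SN];
    [SM];
    [SM; SN];
    [SM; SC];
    [SM; SC; SN];
    [SDbot];
    [SN; SDbot];
    [SDdia];
    [SDbot; SDdia];
    [SN; SDbot; SDdia];
    [SM; SDbot];
    [SM; SN; SDbot];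
    [SM; SDbot; SDdia];
    [SM; SN; SDbot; SDdia];
    [SM; SC; SDbot; SDdia];
    [SM; SC; SN; SDbot; SDdia] ].

(* Main.v *)
Require Import Defs.
From Stdlib Require Import List Bool Arith Classical ClassicalEpsilon.
Import ListNotations.

(** Suppose that [A] implies no formula of the common language which in turn
    implies [B]. Call a pair of formulas, the first in the language of [A] and
    the second in that of [B], inseparable if no common formula follows from the
    first and is refuted by the second; [(A, Neg B)] is inseparable. The
    inseparable pairs deciding every subformula of [A] on the first side and
    every subformula of [B] on the second are the worlds of a neighbourhood
    model, whose neighbourhoods are the extensions of the formulas boxed on
    either side (their supersets in the presence of M, supersets of their
    intersections in the presence of M and C). A separating formula can be moved
    under [Box], and this yields both the frame conditions of the logic and the
    truth lemma, so some world satisfies [A] and refutes [B]. *)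

Lemma form_eq_dec (A B : form) : {A = B} + {A <> B}.
Proof. decide equality; apply Nat.eq_dec. Defined.

(** * Propositional reasoning *)

Fixpoint beval (v : form -> bool) (A : form) : bool :=
  match A with
  | Bot => false
  | And B C => andb (beval v B) (beval v C)
  | Or B C => orb (beval v B) (beval v C)
  | Imp B C => implb (beval v B) (beval v C)
  | Var _ | Box _ => v A
  end.

Fixpoint atoms (A : form) : list form :=
  match A with
  | Bot => []
  | And B C | Or B C | Imp B C => atoms B ++ atoms C
  | Var _ | Box _ => [A]
  end.

(** Numbers the atoms, so that a formula becomes a substitution instance of its own [template].
    Boxed formulas count as atoms here. *)
Fixpoint index (l : list form) (A : form) : nat :=
  match l with
  | [] => 0
  | B :: l' => if form_eq_dec A B then 0 else S (index l' A)
  end.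

Fixpoint template (l : list form) (A : form) : pform :=
  match A with
  | Bot => PBot
  | And B C => PAnd (template l B) (template l C)
  | Or B C => POr (template l B) (template l C)
  | Imp B C => PImp (template l B) (template l C)
  | Var _ | Box _ => PVar (index l A)
  end.

Lemma nth_index (l : list form) (A : form) :
  In A l -> nth (index l A) l Bot = A.
Proof.
  induction l as [|B l IH]; simpl; [easy|].
  destruct (form_eq_dec A B) as [->|ne]; [easy|].
  intros [->|h]; [easy|auto].
Qed.

Lemma psubst_template (l : list form) (A : form) :
  incl (atoms A) l -> psubst (fun n => nth n l Bot) (template l A) = A.
Proof.
  induction A; simpl; intros h;
    try (apply incl_app_inv in h; destruct h; f_equal; auto; fail);
    try (apply nth_index, h; left; reflexivity).
  reflexivity.
Qed.

Lemma peval_template (l : list form) (v : nat -> bool) (A : form) :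
  peval v (template l A) = beval (fun B => v (index l B)) A.
Proof. induction A; simpl; congruence. Qed.

Lemma thm_beval (X : list scheme) (A : form) :
  (forall v, beval v A = true) -> thm X A.
Proof.
  intros h.
  rewrite <- (psubst_template (atoms A) A) by apply incl_refl.
  apply thm_taut; intros v; rewrite peval_template; apply h.
Qed.

(* Discharges the hypotheses [thm X _] of the goal into the antecedent of a
   propositional tautology, which is then checked by truth tables. *)
Ltac taut :=
  repeat match goal with
    | H : thm ?X ?A |- thm ?X _ => apply (thm_mp X A); [clear H | exact H]
    end;
  apply thm_beval;
  let v := fresh "v" in
  intro v; simpl;
  repeat match goal with
    | |- context [beval v ?x] => destruct (beval v x); simpl; try reflexivity
    | |- context [v ?x] => destruct (v x); simpl; try reflexivity
    end.

(** * Derived rules for [Box] *)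

Section Interpolation.

Context (X : list scheme).

Lemma box_equiv (A B : form) :
  thm X (Imp A B) -> thm X (Imp B A) -> thm X (Imp (Box A) (Box B)).
Proof.
  intros h1 h2.
  assert (h : thm X (Iff A B)) by taut.
  clear h1 h2; apply thm_re in h; taut.
Qed.

(** Under M, [A] is equivalent to [And A B], so RE followed by M applies. Without M only RE remains,
    and it asks for the converse implication; the disjunction lets later proofs treat both cases at
    once. *)
Lemma box_mono (A B : form) :
  thm X (Imp A B) -> In SM X \/ thm X (Imp B A) ->
  thm X (Imp (Box A) (Box B)).
Proof.
  intros h [hM|h']; [|now apply box_equiv].
  assert (h1 : thm X (Imp (Box A) (Box (And A B)))) by (apply box_equiv; taut).
  assert (h2 := thm_ax X SM _ hM (inst_M A B)).
  clear h; taut.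
Qed.

Lemma box_mono2 (A B C : form) :
  In SM X -> In SC X -> thm X (Imp (And A B) C) ->
  thm X (Imp (And (Box A) (Box B)) (Box C)).
Proof.
  intros hM hC h.
  assert (h1 := box_mono (And A B) C h (or_introl hM)).
  assert (h2 := thm_ax X SC _ hC (inst_C A B)).
  clear h; taut.
Qed.

(* [S true] is the antecedent and [S false] the consequent to be interpolated. *)
Context (S : bool -> form).

Definition lang (s : bool) (A : form) : Prop :=
  forall p, occurs p A -> occurs p (S s).

Fixpoint sub (A : form) : list form :=
  A :: match A with
       | Var _ | Bot => []
       | And B C | Or B C | Imp B C => sub B ++ sub C
       | Box B => sub B
       end.

Lemma in_sub_self (A : form) : In A (sub A).
Proof. destruct A; left; reflexivity. Qed.

Lemma occurs_sub (A B : form) (p : nat) :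
  In B (sub A) -> occurs p B -> occurs p A.
Proof.
  induction A; simpl; intros [<-|h] hp; try apply in_app_or in h;
    simpl in *; intuition.
Qed.

(* Deciding [Box Top] makes the two sides agree on whether anything at all is
   boxed when M holds but N may fail; [nbr_of_box] relies on this. *)
Definition relevant (s : bool) : list form := Box Top :: sub (S s).

Lemma lang_relevant (s : bool) (A : form) : In A (relevant s) -> lang s A.
Proof.
  intros [<-|h] p hp; [simpl in hp; tauto|].
  exact (occurs_sub _ _ _ h hp).
Qed.

(** * Separable pairs *)

Definition separable (G : bool -> form) : Prop :=
  exists I, (forall s, lang s I) /\
    thm X (Imp (G true) I) /\ thm X (Imp (G false) (Neg I)).

Lemma lang_intro (s : bool) (A : form) :
  match A with
  | Var p => occurs p (S s)
  | Bot => True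
  | And B C | Or B C | Imp B C => lang s B /\ lang s C
  | Box B => lang s B
  end -> lang s A.
Proof.
  unfold lang; destruct A; simpl; intros h q; intuition (subst; auto).
Qed.

Ltac lang_tac :=
  repeat (match goal with
    | |- lang _ ?A => first [assumption
        | match goal with H : forall s, lang s _ |- _ => solve [apply H] end
        | apply lang_intro; simpl]
    | |- _ /\ _ => split
    | |- True => exact I
    end).

(** Negating the separator exchanges the sides, so later arguments may work on an arbitrary side. *)
Lemma separable_sym (G : bool -> form) (t : bool) :
  separable G <->
  exists I, (forall s, lang s I) /\
    thm X (Imp (G t) I) /\ thm X (Imp (G (negb t)) (Neg I)).
Proof.
  destruct t; simpl; [reflexivity|].
  split; intros (I & hI & h1 & h2); exists (Neg I);
    (split; [intros s; lang_tac|split; taut]).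
Qed.

Lemma inconsistent_separable (G : bool -> form) (t : bool) :
  thm X (Imp (G t) Bot) -> separable G.
Proof.
  intros h; apply (separable_sym G t); exists Bot.
  split; [intros s; lang_tac|split; [exact h|taut]].
Qed.

(** The case [s = t] is allowed: that side is then inconsistent, and [Bot] or its negation
    separates. *)
Lemma separable_by (G : bool -> form) (s t : bool) (I : form) :
  lang s I -> lang t I -> thm X (Imp (G s) I) -> thm X (Imp (G t) (Neg I)) ->
  separable G.
Proof.
  intros hs ht h1 h2.
  destruct (bool_dec s t) as [<-|ne].
  - apply (inconsistent_separable G s); taut.
  - apply (separable_sym G s); exists I.
    assert (t = negb s) as -> by (destruct s, t; simpl; congruence).
    split; [|tauto].
    intros r; destruct (bool_dec r s) as [->|]; [exact hs|].
    now assert (r = negb s) as -> by (destruct s, r; simpl; congruence).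
Qed.

Definition add (G : bool -> form) (s : bool) (A : form) : bool -> form :=
  fun t => if bool_dec t s then And (G t) A else G t.

Lemma add_same (G : bool -> form) (s : bool) (A : form) :
  add G s A s = And (G s) A.
Proof. unfold add; destruct (bool_dec s s); congruence. Qed.

Lemma add_other (G : bool -> form) (s : bool) (A : form) :
  add G s A (negb s) = G (negb s).
Proof. unfold add; destruct s; reflexivity. Qed.

Lemma add_entails (G : bool -> form) (s t : bool) (A : form) :
  thm X (Imp (add G s A t) (G t)).
Proof. unfold add; destruct (bool_dec t s); taut. Qed.

Lemma lang_add (G : bool -> form) (s : bool) (A : form) :
  (forall t, lang t (G t)) -> lang s A -> forall t, lang t (add G s A t).
Proof.
  intros hG hA t; unfold add; destruct (bool_dec t s) as [->|]; [|apply hG].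
  apply lang_intro; auto.
Qed.

(** If both extensions had separators, their disjunction would separate [G]: side [s] implies it by
    cases on [A], and the other side refutes both disjuncts. *)
Lemma inseparable_decide (G : bool -> form) (s : bool) (A : form) :
  ~ separable G -> ~ separable (add G s A) \/ ~ separable (add G s (Neg A)).
Proof.
  intros hG; apply NNPP; intros h; apply hG.
  apply not_or_and in h; destruct h as [h1 h2].
  apply NNPP, (separable_sym _ s) in h1; apply NNPP, (separable_sym _ s) in h2.
  rewrite add_same, add_other in h1, h2.
  destruct h1 as (I & hI & h1 & h1'), h2 as (J & hJ & h2 & h2').
  apply (separable_sym _ s); exists (Or I J).
  split; [intros t; lang_tac|split].
  - clear h1' h2'; taut.
  - clear h1 h2; taut.
Qed.

(** A finite Lindenbaum construction: with finitely many decisions, one formula per side takes the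
    place of a maximal consistent set. *)
Lemma inseparable_decide_list (l : list (bool * form)) (G : bool -> form) :
  (forall s A, In (s, A) l -> lang s A) ->
  (forall s, lang s (G s)) -> ~ separable G ->
  exists H : bool -> form,
    (forall s, lang s (H s)) /\ ~ separable H /\
    (forall s, thm X (Imp (H s) (G s))) /\
    (forall s A, In (s, A) l -> thm X (Imp (H s) A) \/ thm X (Imp (H s) (Neg A))).
Proof.
  revert G; induction l as [|[s A] l IH]; intros G hl hG hsep.
  - exists G; repeat split; auto; [intros s; taut|easy].
  - assert (step : exists C, (C = A \/ C = Neg A) /\ ~ separable (add G s C)).
    { destruct (inseparable_decide G s A hsep) as [h|h]; eauto. }
    destruct step as (C & hC & hsep').
    assert (hA : lang s A) by (apply hl; left; reflexivity).
    assert (hCl : lang s C) by (destruct hC as [-> | ->]; lang_tac).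
    destruct (IH (add G s C)) as (H & h1 & h2 & h3 & h4);
      [intros; apply hl; now right|now apply lang_add|exact hsep'|].
    exists H; repeat split; auto.
    + intros t; assert (a := h3 t); assert (b := add_entails G s t C).
      clear - a b; taut.
    + intros t B [e|h]; [|auto].
      injection e as <- <-.
      assert (a := h3 s); rewrite add_same in a; clear - a hC.
      destruct hC as [-> | ->]; [left|right]; taut.
Qed.

(** * Worlds and interpolation between extensions *)

Record world : Type := World {
  theory :> bool -> form;
  theory_lang : forall s, lang s (theory s);
  theory_insep : ~ separable theory;
  theory_decides : forall s A, In A (relevant s) ->
    thm X (Imp (theory s) A) \/ thm X (Imp (theory s) (Neg A)) }.

Lemma world_extends (G : bool -> form) :
  (forall s, lang s (G s)) -> ~ separable G ->
  exists w : world, forall s, thm X (Imp (w s) (G s)).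
Proof.
  intros hG hsep.
  destruct (inseparable_decide_list
    (map (pair true) (relevant true) ++ map (pair false) (relevant false)) G)
    as (H & h1 & h2 & h3 & h4); auto.
  - intros s A h; apply in_app_or in h.
    destruct h as [h|h]; apply in_map_iff in h; destruct h as (B & e & h);
      injection e as <- <-; now apply lang_relevant.
  - unshelve eexists (World H h1 h2 _); [|exact h3].
    intros s A h; apply h4, in_or_app.
    destruct s; [left|right]; now apply in_map.
Qed.

Definition holds (w : world) (s : bool) (A : form) : Prop :=
  thm X (Imp (w s) A).

Lemma holds_coherent (w : world) (s t : bool) (A : form) :
  lang s A -> lang t A -> holds w s A -> ~ holds w t (Neg A).
Proof.
  intros hs ht h1 h2; exact (theory_insep w (separable_by w s t A hs ht h1 h2)).
Qed.

Lemma holds_consistent (w : world) (s : bool) (A : form) :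
  holds w s A -> ~ holds w s (Neg A).
Proof.
  unfold holds; intros h1 h2.
  apply (theory_insep w), (inconsistent_separable w s); taut.
Qed.

(** Side [t] decides [A]; if it refuted [A], then [A] itself would separate the two sides. *)
Lemma holds_transfer (w : world) (s t : bool) (A : form) :
  lang s A -> In A (relevant t) -> holds w s A -> holds w t A.
Proof.
  intros hs ht h.
  destruct (theory_decides w t A ht) as [h'|h']; [exact h'|].
  destruct (holds_coherent w s t A hs (lang_relevant t A ht) h h').
Qed.

Lemma holds_imp (w : world) (s : bool) (A B : form) :
  thm X (Imp A B) -> holds w s A -> holds w s B.
Proof. unfold holds; intros h1 h2; taut. Qed.

Lemma separated_of_disjoint (s t : bool) (A B : form) :
  lang s A -> lang t B -> (forall w, holds w s A -> ~ holds w t B) ->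
  exists I, lang s I /\ lang t I /\ thm X (Imp A I) /\ thm X (Imp B (Neg I)).
Proof.
  intros hA hB hdisj.
  set (G := add (add (fun _ => Top) s A) t B).
  assert (hG : separable G).
  { apply NNPP; intros hG; destruct (world_extends G) as [w hw]; auto.
    - apply lang_add; [apply lang_add|]; auto; intros r; lang_tac.
    - apply (hdisj w).
      + assert (a := hw s).
        assert (c := add_entails (add (fun _ => Top) s A) t s B).
        rewrite add_same in c; unfold holds; fold G in c; taut.
      + assert (a := hw t); unfold G in a; rewrite add_same in a.
        unfold holds; taut. }
  apply (separable_sym _ s) in hG; destruct hG as (I & hI & h1 & h2).
  unfold G in h1, h2.
  destruct (bool_dec s t) as [<-|ne].
  (* On a single side the opposite theory is just [Top], so separability makes [A] and [B]
     contradictory and [A] serves as separator. *)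
  - rewrite add_same, add_same in h1; rewrite add_other, add_other in h2.
    exists A; repeat split; auto; taut.
  - assert (t = negb s) as -> by (destruct s, t; simpl; congruence).
    rewrite add_same, add_other in h2.
    assert (e : add (add (fun _ => Top) s A) (negb s) B s = And Top A)
      by (destruct s; reflexivity).
    rewrite e in h1.
    exists I; repeat split; auto; [clear h2|clear h1]; taut.
Qed.

Lemma interpolant_of_subset (s t : bool) (A B : form) :
  lang s A -> lang t B -> (forall w, holds w s A -> holds w t B) ->
  exists I, lang s I /\ lang t I /\ thm X (Imp A I) /\ thm X (Imp I B).
Proof.
  intros hA hB h.
  destruct (separated_of_disjoint s t A (Neg B)) as (I & h1 & h2 & h3 & h4);
    auto.
  - lang_tac.
  - intros w hw; apply holds_consistent; auto.
  - exists I; repeat split; auto; clear h3; taut.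
Qed.

(** * The neighbourhood model *)

(** The last conjunct makes [U] the exact extension of [A] unless M permits supersets. *)
Definition nbr_basic (w : world) (U : world -> Prop) : Prop :=
  exists s A, lang s A /\ holds w s (Box A) /\
    (forall u, holds u s A -> U u) /\
    (In SM X \/ forall u, U u -> holds u s A).

(** One boxed formula per side is enough, since C merges those of the same side into a
    conjunction. *)
Definition nbr_meet (w : world) (U : world -> Prop) : Prop :=
  exists F : bool -> form,
    (forall s, lang s (F s)) /\ (forall s, holds w s (Box (F s))) /\
    (forall u, (forall s, holds u s (F s)) -> U u).

Definition nbr (w : world) (U : world -> Prop) : Prop :=
  (In SC X /\ nbr_meet w U) \/ (~ In SC X /\ nbr_basic w U).

(** These two closure conditions are all that is extracted from membership in [logics]. *)
Context (C_implies_M : In SC X -> In SM X)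
        (C_Ddia_implies_Dbot : In SC X -> In SDdia X -> In SDbot X).

Lemma nbr_ext (w : world) (U V : world -> Prop) :
  (forall u, U u <-> V u) -> nbr w U -> nbr w V.
Proof.
  intros h [[hC (F & h1 & h2 & h3)]|[hC (s & A & h1 & h2 & h3 & h4)]].
  - left; split; auto; exists F; repeat split; auto; intros; apply h; auto.
  - right; split; auto; exists s, A; repeat split; auto.
    + intros; apply h; auto.
    + destruct h4 as [h4|h4]; [auto|right; intros; apply h4, h; auto].
Qed.

Lemma nbr_mono (w : world) (U V : world -> Prop) :
  In SM X -> (forall u, U u -> V u) -> nbr w U -> nbr w V.
Proof.
  intros hM h [[hC (F & h1 & h2 & h3)]|[hC (s & A & h1 & h2 & h3 & h4)]].
  - left; split; auto; exists F; auto.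
  - right; split; auto; exists s, A; auto 6.
Qed.

Lemma nbr_inter (w : world) (U V : world -> Prop) :
  In SC X -> nbr w U -> nbr w V -> nbr w (fun u => U u /\ V u).
Proof.
  intros hC [[_ (F & h1 & h2 & h3)]|[]] [[_ (F' & h1' & h2' & h3')]|[]];
    try tauto.
  left; split; auto.
  exists (fun s => And (F s) (F' s)); repeat split.
  - intros s; apply lang_intro; auto.
  - intros s; assert (a := h2 s); assert (b := h2' s).
    assert (c := thm_ax X SC _ hC (inst_C (F s) (F' s))).
    unfold holds in *; clear - a b c; taut.
  - apply h3; intros s; apply (holds_imp u s _ _) with (2 := H s); taut.
  - apply h3'; intros s; apply (holds_imp u s _ _) with (2 := H s); taut.
Qed.

Lemma nbr_of_box (w : world) (s : bool) (A : form) :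
  lang s A -> holds w s (Box A) -> nbr w (fun u => holds u s A).
Proof.
  intros hA h; destruct (classic (In SC X)) as [hC|hC].
  - left; split; auto.
    (* [Top] fills the other side of the meet. M yields [Box Top] on side [s], and its relevance
       carries it across. *)
    assert (hT : forall t, holds w t (Box Top)).
    { intros t; apply (holds_transfer w s); [lang_tac|left; reflexivity|].
      apply (holds_imp w s (Box A)); [|exact h].
      apply box_mono; [taut|auto]. }
    exists (fun t => if bool_dec t s then A else Top); split; [|split].
    + intros t; destruct (bool_dec t s) as [->|]; lang_tac.
    + intros t; destruct (bool_dec t s) as [->|]; auto.
    + intros u hu; specialize (hu s); destruct (bool_dec s s); easy.
  - right; split; auto; exists s, A; auto 6.
Qed.

(** An interpolant is moved under [Box], whereupon one side asserts and the other refutes the same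
    boxed common formula. With C that formula is [Box (Neg I)], where [I] separates [F] with [Neg A]
    added on side [s]; otherwise it is [Box I], with [I] between [B] and [A]. *)
Lemma nbr_not_neg_box (w : world) (s : bool) (A : form) :
  lang s A -> nbr w (fun u => holds u s A) -> ~ holds w s (Neg (Box A)).
Proof.
  intros hA [[hC (F & h1 & h2 & h3)]|[_ (t & B & h1 & h2 & h3 & h4)]] hn.
  - assert (hsep : separable (add F s (Neg A))).
    { apply NNPP; intros hG.
      destruct (world_extends (add F s (Neg A))) as [u hu]; [|exact hG|].
      - apply lang_add; [auto|lang_tac].
      - assert (a := hu s); rewrite add_same in a.
        apply (holds_consistent u s A); [|unfold holds; taut].
        apply h3; intros t; assert (b := hu t).
        assert (c := add_entails F s t (Neg A)).
        unfold holds; clear a; taut. }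
    apply (separable_sym _ s) in hsep; rewrite add_same, add_other in hsep.
    destruct hsep as (I & hI & k1 & k2).
    apply (holds_coherent w (negb s) s (Box (Neg I))); [lang_tac|lang_tac| |].
    + apply (holds_imp w _ (Box (F (negb s)))); auto.
      apply box_mono; auto.
    + assert (a := h2 s).
      assert (b : thm X (Imp (And (Box (F s)) (Box (Neg I))) (Box A))).
      { apply box_mono2; auto; clear - k1; taut. }
      unfold holds in *; clear k1 k2; taut.
  - destruct (interpolant_of_subset t s B A) as (I & i1 & i2 & i3 & i4); auto.
    (* Without M the two extensions coincide, so [B], [I] and [A] are equivalent and RE applies. *)
    assert (conv : In SM X \/ thm X (Imp A B)).
    { destruct h4 as [h4|h4]; [auto|right].
      destruct (interpolant_of_subset s t A B) as (J & _ & _ & j1 & j2); auto.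
      clear - j1 j2; taut. }
    apply (holds_coherent w t s (Box I)); [lang_tac|lang_tac| |].
    + apply (holds_imp w t (Box B)); auto.
      apply box_mono; auto.
      destruct conv as [hM|k]; [auto|right; clear - k i4; taut].
    + apply (holds_imp w s (Neg (Box A))); auto.
      assert (b : thm X (Imp (Box I) (Box A))).
      { apply box_mono; auto.
        destruct conv as [hM|k]; [auto|right; clear - k i3; taut]. }
      clear - b; taut.
Qed.

Lemma nbr_full (w : world) : In SN X -> nbr w (fun _ => True).
Proof.
  intros hN; apply (nbr_ext w (fun u => holds u true Top)).
  - intros u; split; [easy|intros _; unfold holds; taut].
  - apply nbr_of_box; [lang_tac|].
    assert (h := thm_ax X SN _ hN inst_N); unfold holds; taut.
Qed.

Lemma nbr_empty (w : world) : In SDbot X -> ~ nbr w (fun _ => False).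
Proof.
  intros hD h; apply (nbr_not_neg_box w true Bot); [lang_tac| |].
  - apply nbr_ext with (2 := h); intros u; split; [easy|intros hb].
    apply (holds_consistent u true Bot hb); unfold holds; taut.
  - assert (k := thm_ax X SDbot _ hD inst_Dbot); unfold holds; taut.
Qed.

(** With C, intersecting the two sets contradicts [nbr_empty]. Otherwise a separator [I] of the
    boxed formulas gives [Box I] on one side, hence the negation of [Box (Neg I)] by the deontic
    scheme, against [Box (Neg I)] on the other. *)
Lemma nbr_compl (w : world) (U : world -> Prop) :
  In SDdia X -> nbr w U -> ~ nbr w (fun u => ~ U u).
Proof.
  intros hD hU hV; destruct (classic (In SC X)) as [hC|hC].
  - apply (nbr_empty w); auto.
    apply nbr_ext with (2 := nbr_inter w _ _ hC hU hV); tauto.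
  - destruct hU as [[]|[_ (s & A & a1 & a2 & a3 & a4)]]; [tauto|].
    destruct hV as [[]|[_ (t & B & b1 & b2 & b3 & b4)]]; [tauto|].
    destruct (separated_of_disjoint s t A B) as (I & i1 & i2 & i3 & i4); auto.
    { intros u h1 h2; exact (b3 u h2 (a3 u h1)). }
    (* Without M the extensions of [A] and [B] are exact complements, so [A] is equivalent to [I]
       and [B] to [Neg I]. *)
    assert (conv : In SM X \/ thm X (Imp (Neg A) B)).
    { destruct a4 as [hM|a4]; [auto|]; destruct b4 as [hM|b4]; [auto|right].
      destruct (separated_of_disjoint s t (Neg A) (Neg B))
        as (J & _ & _ & j1 & j2); [lang_tac|lang_tac| |clear - j1 j2; taut].
      intros u h1 h2.
      apply (holds_consistent u t B); [|exact h2].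
      apply b4; intros k; exact (holds_consistent u s A (a4 u k) h1). }
    apply (holds_coherent w t s (Box (Neg I))); [lang_tac|lang_tac| |].
    + apply (holds_imp w t (Box B)); auto; apply box_mono; auto.
      destruct conv as [hM|k]; [auto|right; clear - k i3; taut].
    + apply (holds_imp w s (Box A)); auto.
      assert (k1 : thm X (Imp (Box A) (Box I))).
      { apply box_mono; auto.
        destruct conv as [hM|k]; [auto|right; clear - k i4; taut]. }
      assert (k2 := thm_ax X SDdia _ hD (inst_Ddia I)).
      clear - k1 k2; unfold Dia in k2; taut.
Qed.

(** * Satisfaction, soundness and the truth lemma *)

Fixpoint sat (A : form) (w : world) : Prop :=
  match A with
  | Var p => exists s, occurs p (S s) /\ holds w s (Var p)
  | Bot => False
  | And B C => sat B w /\ sat C w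
  | Or B C => sat B w \/ sat C w
  | Imp B C => sat B w -> sat C w
  | Box B => nbr w (sat B)
  end.

Lemma sat_psubst (w : world) (f : nat -> form) (P : pform) :
  sat (psubst f P) w <->
  peval (fun n => if excluded_middle_informative (sat (f n) w)
                  then true else false) P = true.
Proof.
  induction P; simpl.
  - destruct (excluded_middle_informative (sat (f n) w)); intuition congruence.
  - intuition congruence.
  - rewrite IHP1, IHP2, andb_true_iff; reflexivity.
  - rewrite IHP1, IHP2, orb_true_iff; reflexivity.
  - rewrite IHP1, IHP2, implb_true_iff; reflexivity.
Qed.

Lemma soundness (A : form) : thm X A -> forall w, sat A w.
Proof.
  induction 1 as [P f hP|T A hT inst|A B _ IH1 _ IH2|A B _ IH]; intros w.
  - apply sat_psubst, hP.
  - destruct inst; simpl.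
    + intros h; split; apply nbr_mono with (3 := h); auto; simpl; tauto.
    + intros [h1 h2]; exact (nbr_inter w _ _ hT h1 h2).
    + apply nbr_ext with (2 := nbr_full w hT); tauto.
    + exact (nbr_empty w hT).
    + exact (nbr_compl w _ hT).
  - exact (IH1 w (IH2 w)).
  - simpl in *; split; apply nbr_ext; intros u; specialize (IH u); tauto.
Qed.

(** Restricted to subformulas of [S s], which side [s] is sure to decide. *)
Lemma truth (s : bool) (A : form) :
  incl (sub A) (sub (S s)) -> forall w, sat A w <-> holds w s A.
Proof.
  assert (dec : forall A w, incl (sub A) (sub (S s)) ->
    holds w s A \/ holds w s (Neg A)).
  { intros B w h; apply theory_decides; right; apply h, in_sub_self. }
  assert (lng : forall A, incl (sub A) (sub (S s)) -> lang s A).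
  { intros B h; apply lang_relevant; right; apply h, in_sub_self. }
  induction A as [p| |A IHA B IHB|A IHA B IHB|A IHA B IHB|A IHA]; intros h w;
    simpl;
    try (assert (hA : incl (sub A) (sub (S s)))
           by (intros C hC; apply h; simpl; auto using in_or_app));
    try (assert (hB : incl (sub B) (sub (S s)))
           by (intros C hC; apply h; simpl; auto using in_or_app));
    try specialize (IHA hA); try specialize (IHB hB).
  - split.
    (* The variable may be asserted by the opposite side only; it then occurs in both formulas and
       transfers to side [s]. *)
    + intros (t & ht & hp); apply (holds_transfer w t); auto.
      * apply lang_intro; exact ht.
      * right; apply h, in_sub_self.
    + intros hp; exists s; split; [|exact hp].
      apply (lng (Var p) h p); reflexivity.
  - split; [easy|intros hb].
    apply (holds_consistent w s Bot hb); unfold holds; taut.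
  - rewrite IHA, IHB; unfold holds; split.
    + intros [a b]; clear - a b; taut.
    + intros a; clear - a; split; taut.
  - rewrite IHA, IHB; assert (d := dec A w hA); unfold holds in *; split.
    + intros [a|a]; clear - a; taut.
    + intros a; destruct d as [d|d]; [auto|right; clear - a d; taut].
  - rewrite IHA, IHB; assert (d := dec A w hA); unfold holds in *; split.
    + intros a; destruct d as [d|d]; [specialize (a d); clear - a|clear - d]; taut.
    + intros a b; clear - a b; taut.
  - assert (e : forall u, holds u s A <-> sat A u) by (intros u; symmetry; apply IHA).
    split; intros k.
    + destruct (dec (Box A) w h) as [d|d]; [exact d|].
      destruct (nbr_not_neg_box w s A); auto.
      apply nbr_ext with (2 := k); intros u; symmetry; apply e.
    + apply nbr_ext with (1 := e); apply nbr_of_box; auto.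
Qed.

End Interpolation.

Theorem theorem7 (X : list scheme) (hX : In X logics) (A B : form)
    (hAB : thm X (Imp A B)) :
  exists I : form,
    (forall p : nat, occurs p I -> occurs p A /\ occurs p B) /\
    thm X (Imp A I) /\ thm X (Imp I B).
Proof.
  assert (hM : In SC X -> In SM X)
    by (simpl in hX; intuition (subst; simpl in *; intuition congruence)).
  assert (hD : In SC X -> In SDdia X -> In SDbot X)
    by (simpl in hX; intuition (subst; simpl in *; intuition congruence)).
  set (S := fun s : bool => if s then A else B).
  (* A separator of this pair is an interpolant, by contraposition on the second side. *)
  set (G := fun s : bool => if s then A else Neg B).
  assert (hG : separable X S G).
  { apply NNPP; intros hG.
    destruct (world_extends X S G) as [w hw]; auto.
    { intros [] p; simpl; tauto. }
    apply (holds_consistent X S w false B); [|exact (hw false)].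
    apply (truth X S hM false B); [apply incl_refl|].
    apply (soundness X S hM hD _ hAB).
    apply (truth X S hM true A); [apply incl_refl|exact (hw true)]. }
  destruct hG as (I & hI & h1 & h2); simpl in h1, h2.
  exists I; repeat split.
  - exact (hI true p H).
  - exact (hI false p H).
  - exact h1.
  - clear - h2; taut.
Qed.
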